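(* Let $(M,J,g)$ be an integrable LCK manifold such that the Lee vector field $U$ is Killing for $g$. Then the Riemannian manifold $(M,g)$ is not complete.
   Context: All manifolds are smooth of real dimension $2n+2$ with $n\ge 1$. A Hermitian manifold $(M,J,g)$ consists of a $(1,1)$-tensor field $J$ with $J^2=-\mathrm{Id}$ and vanishing Nijenhuis torsion, and a Riemannian metric $g$ with $g(JX,JY)=g(X,Y)$. Its fundamental $2$-form is $\Omega(X,Y)=g(X,JY)$. The codifferential is $\delta=-\sum_k i_{E_k}\nabla_{E_k}$ for a local orthonormal frame $(E_k)$ and the Levi-Civita connection $\nabla$. The anti-Lee $1$-form is $\eta=\frac1n\delta\Omega$ and the Lee $1$-form is $\theta(X)=\eta(JX)$; equivalently $\eta(X)=-\theta(JX)$. The manifold is locally conformal Kähler (LCK) if $d\Omega=\theta\wedge\Omega$ and $d\theta=0$, where $(\theta\wedge\Omega)(X,Y,Z)=\theta(X)\Omega(Y,Z)+\theta(Y)\Omega(Z,X)+\theta(Z)\Omega(X,Y)$. The Lee and anti-Lee vector fields $U,V$ are the metric duals of $\theta,\eta$: $\theta=g(U,\cdot)$, $\eta=g(V,\cdot)$ (so $V=JU$). An LCK manifold is integrable if $V$ is nowhere zero and the distribution $V^\perp=\ker\eta$ is integrable. *)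

(* Defs.v *)
From HB Require Import structures.
From mathcomp Require Import all_boot all_order all_algebra.
From mathcomp Require Import all_classical all_reals all_analysis.
Set Implicit Arguments.
Unset Strict Implicit.
Unset Printing Implicit Defensive.
Import Order.TTheory GRing.Theory Num.Theory.
Import numFieldNormedType.Exports.
Local Open Scope classical_set_scope.
Local Open Scope ring_scope.

(** * Smooth maps and smooth manifolds *)

(* Meant for an open set [A]: f is C^(k+1) when it is differentiable and its
   derivative in every (constant) direction is C^k. *)
Fixpoint Ck_on (R : realType) (V W : normedModType R) (k : nat)
    (A : set V) (f : V -> W) {struct k} : Prop :=
  match k with
  | 0%N => forall x, A x -> {for x, continuous f}
  | k'.+1 => (forall x, A x -> differentiable f x) /\
             (forall v : V, Ck_on k' A (fun x => 'D_v f x))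
  end.

Definition smooth_on (R : realType) (V W : normedModType R)
    (A : set V) (f : V -> W) : Prop := forall k, Ck_on k A f.

(* [chart_inv i] is total but only meaningful on [chart_map i @` chart_dom i];
   likewise [chart_map i] only on [chart_dom i]. *)
Record manifold (R : realType) (m : nat) : Type := Manifold {
  space :> topologicalType;
  space_nonempty : [set: space] !=set0;
  space_hausdorff : hausdorff_space space;
  space_second_countable : @second_countable space;
  chart : Type;
  chart_dom : chart -> set space;
  chart_map : chart -> space -> 'rV[R]_m;
  chart_inv : chart -> 'rV[R]_m -> space;
  chart_cover : forall p, exists i, chart_dom i p;
  chart_dom_open : forall i, open (chart_dom i);
  chart_codom_open : forall i, open (chart_map i @` chart_dom i);
  chart_mapK : forall i p, chart_dom i p -> chart_inv i (chart_map i p) = p;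
  chart_map_continuous : forall i p, chart_dom i p ->
    {for p, continuous (chart_map i)};
  chart_inv_continuous : forall i x, (chart_map i @` chart_dom i) x ->
    {for x, continuous (chart_inv i)};
  chart_compatible : forall i j,
    smooth_on (chart_map i @` (chart_dom i `&` chart_dom j))
              (chart_map j \o chart_inv i)
}.

Definition codomain (R : realType) (m : nat) (M : manifold R m) (i : chart M) :
  set 'rV[R]_m := chart_map i @` chart_dom i.

Definition overlap (R : realType) (m : nat) (M : manifold R m)
  (i j : chart M) : set 'rV[R]_m :=
  chart_map i @` (chart_dom i `&` chart_dom j).

Definition transition (R : realType) (m : nat) (M : manifold R m)
  (i j : chart M) : 'rV[R]_m -> 'rV[R]_m := chart_map j \o chart_inv i.

(** * Tensor calculus in a chart *)

(* In a chart, a vector field is a map X from coordinates to components, and a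
   covariant k-tensor is a map T with T x v1 .. vk its value at x on tangent
   vectors v1, .., vk.  Tensorial expressions are evaluated on constant vectors,
   i.e. on vector fields with constant components, whose brackets vanish. *)

Definition basis_vec (R : realType) (m : nat) (a : 'I_m) : 'rV[R]_m :=
  delta_mx 0 a.

Definition bracket (R : realType) (m : nat) (X Y : 'rV[R]_m -> 'rV[R]_m)
    (x : 'rV[R]_m) : 'rV[R]_m :=
  'D_(X x) Y x - 'D_(Y x) X x.

(* An endomorphism field acts on row vectors from the right: J v = v *m J x. *)
Definition appl (R : realType) (m : nat) (J : 'rV[R]_m -> 'M[R]_m)
    (X : 'rV[R]_m -> 'rV[R]_m) (x : 'rV[R]_m) : 'rV[R]_m := X x *m J x.

Definition nijenhuis (R : realType) (m : nat) (J : 'rV[R]_m -> 'M[R]_m)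
    (X Y : 'rV[R]_m -> 'rV[R]_m) (x : 'rV[R]_m) : 'rV[R]_m :=
  bracket (appl J X) (appl J Y) x
  - appl J (bracket (appl J X) Y) x - appl J (bracket X (appl J Y)) x
  - bracket X Y x.

Definition inner (R : realType) (m : nat) (G : 'rV[R]_m -> 'M[R]_m)
    (x v w : 'rV[R]_m) : R := (v *m G x *m w^T) 0 0.

Definition extd1 (R : realType) (m : nat) (t : 'rV[R]_m -> 'rV[R]_m -> R)
    (x v w : 'rV[R]_m) : R :=
  'D_v (fun y => t y w) x - 'D_w (fun y => t y v) x.

Definition extd2 (R : realType) (m : nat)
    (o : 'rV[R]_m -> 'rV[R]_m -> 'rV[R]_m -> R) (x u v w : 'rV[R]_m) : R :=
  'D_u (fun y => o y v w) x + 'D_v (fun y => o y w u) x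
  + 'D_w (fun y => o y u v) x.

Definition wedge12 (R : realType) (m : nat) (t : 'rV[R]_m -> 'rV[R]_m -> R)
    (o : 'rV[R]_m -> 'rV[R]_m -> 'rV[R]_m -> R) (x u v w : 'rV[R]_m) : R :=
  t x u * o x v w + t x v * o x w u + t x w * o x u v.

(* The metric dual: the vector s with inner G x s w = t x w (see sharpP). *)
Definition sharp (R : realType) (m : nat) (G : 'rV[R]_m -> 'M[R]_m)
    (t : 'rV[R]_m -> 'rV[R]_m -> R) (x : 'rV[R]_m) : 'rV[R]_m :=
  (\row_a t x (basis_vec R a)) *m invmx (G x).

Lemma sharpP (R : realType) (m : nat) (G : 'rV[R]_m -> 'M[R]_m)
    (t : 'rV[R]_m -> 'rV[R]_m -> R) (x c w : 'rV[R]_m) :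
  G x \in unitmx -> (forall v, t x v = (c *m v^T) 0 0) ->
  inner G x (sharp G t x) w = t x w.
Proof.
move=> Gu tc; rewrite /inner /sharp mulmxKV // tc.
congr ((_ *m _) 0 0); apply/rowP => a.
rewrite mxE tc /basis_vec trmx_delta mxE (bigD1 a) //= mxE !eqxx mulr1.
by rewrite big1 ?addr0 // => b ba; rewrite mxE (negbTE ba) mulr0.
Qed.

(* Levi-Civita connection: christoffel G x u v is nabla_u v at x for the
   constant fields u, v, given by Koszul's formula
   2 g(nabla_u v, w) = u(g(v,w)) + v(g(u,w)) - w(g(u,v)). *)
Definition christoffel (R : realType) (m : nat) (G : 'rV[R]_m -> 'M[R]_m)
    (x u v : 'rV[R]_m) : 'rV[R]_m :=
  sharp G (fun x w => 2^-1 * ('D_u (fun y => inner G y v w) x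
                             + 'D_v (fun y => inner G y u w) x
                             - 'D_w (fun y => inner G y u v) x)) x.

Definition nabla2 (R : realType) (m : nat) (G : 'rV[R]_m -> 'M[R]_m)
    (o : 'rV[R]_m -> 'rV[R]_m -> 'rV[R]_m -> R) (x u v w : 'rV[R]_m) : R :=
  'D_u (fun y => o y v w) x
  - o x (christoffel G x u v) w - o x v (christoffel G x u w).

(* delta o = - sum_k i_(E_k) nabla_(E_k) o, the trace being written with the
   inverse metric; codiff2_orthonormal is the formula in an orthonormal frame. *)
Definition codiff2 (R : realType) (m : nat) (G : 'rV[R]_m -> 'M[R]_m)
    (o : 'rV[R]_m -> 'rV[R]_m -> 'rV[R]_m -> R) (x w : 'rV[R]_m) : R :=
  - \sum_(a < m) \sum_(b < m)
      invmx (G x) a b * nabla2 G o x (basis_vec R a) (basis_vec R b) w.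

Lemma codiff2_orthonormal (R : realType) (m : nat) (G : 'rV[R]_m -> 'M[R]_m)
    (o : 'rV[R]_m -> 'rV[R]_m -> 'rV[R]_m -> R) (x w : 'rV[R]_m)
    (N E : 'M[R]_m) :
  (forall u v, nabla2 G o x u v w = (u *m N *m v^T) 0 0) ->
  (forall k l, inner G x (row k E) (row l E) = (k == l)%:R) ->
  codiff2 G o x w = - \sum_(k < m) nabla2 G o x (row k E) (row k E) w.
Proof.
have entry (A : 'M[R]_m) k l : (row k E *m A *m (row l E)^T) 0 0 =
    (E *m A *m E^T) k l.
  rewrite -!row_mul !mxE; apply: eq_bigr => j _.
  by rewrite !mxE.
move=> oN orthE.
have EGE : E *m G x *m E^T = 1%:M.
  by apply/matrixP => k l; rewrite -entry -/(inner G x _ _) orthE mxE.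
have Einv : invmx (G x) = E^T *m E.
  have GEE : G x *m (E^T *m E) = 1%:M.
    rewrite mulmxA; apply: mulmx1C; rewrite mulmxA; exact: EGE.
  have [Gu _] := mulmx1_unit GEE.
  by rewrite -[LHS]mulmx1 -GEE mulKmx.
have -> : \sum_k nabla2 G o x (row k E) (row k E) w = \tr (E *m N *m E^T).
  by apply: eq_bigr => k _; rewrite oN entry.
congr (- _); rewrite mxtrace_mulC mulmxA -Einv.
have symI a b : invmx (G x) a b = invmx (G x) b a.
  have : (invmx (G x))^T = invmx (G x) by rewrite Einv trmx_mul trmxK.
  by move/matrixP/(_ b a); rewrite mxE.
rewrite /mxtrace exchange_big /=; apply: eq_bigr => b _.
rewrite mxE; apply: eq_bigr => a _; rewrite oN symI; congr (_ * _).
by rewrite /basis_vec trmx_delta -rowE -colE !mxE.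
Qed.

Definition lie_metric (R : realType) (m : nat) (G : 'rV[R]_m -> 'M[R]_m)
    (X : 'rV[R]_m -> 'rV[R]_m) (x v w : 'rV[R]_m) : R :=
  'D_(X x) (fun y => inner G y v w) x
  - inner G x (bracket X (cst v) x) w - inner G x v (bracket X (cst w) x).

(** * Riemannian and Hermitian structures *)

Record riemannian (R : realType) (m : nat) (M : manifold R m) : Type :=
  Riemannian {
  gram :> chart M -> 'rV[R]_m -> 'M[R]_m;
  gram_smooth : forall i, smooth_on (codomain i) (gram i);
  gram_change : forall i j x, overlap i j x ->
    let T := 'J (transition i j) x in
    gram i x = T *m gram j (transition i j x) *m T^T;
  gram_sym : forall i x, codomain i x -> (gram i x)^T = gram i x;
  gram_pos : forall i x v, codomain i x -> v != 0 -> 0 < inner (gram i) x v v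
}.

Record complex_structure (R : realType) (m : nat) (M : manifold R m) : Type :=
  ComplexStructure {
  cplx :> chart M -> 'rV[R]_m -> 'M[R]_m;
  cplx_smooth : forall i, smooth_on (codomain i) (cplx i);
  cplx_change : forall i j x, overlap i j x ->
    let T := 'J (transition i j) x in
    cplx i x *m T = T *m cplx j (transition i j x);
  cplx_sqr : forall i x, codomain i x -> cplx i x *m cplx i x = - 1%:M;
  cplx_nijenhuis : forall i (X Y : 'rV[R]_m -> 'rV[R]_m),
    smooth_on (codomain i) X -> smooth_on (codomain i) Y ->
    forall x, codomain i x -> nijenhuis (cplx i) X Y x = 0
}.

Definition hermitian (R : realType) (m : nat) (M : manifold R m)
    (J : complex_structure M) (g : riemannian M) : Prop :=
  forall i x v w, codomain i x ->
    inner (g i) x (v *m J i x) (w *m J i x) = inner (g i) x v w.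

(** * Lee forms, in real dimension 2n+2 *)

Definition fundamental_form (R : realType) (m : nat) (M : manifold R m)
    (J : complex_structure M) (g : riemannian M) (i : chart M)
    (x v w : 'rV[R]_m) : R := inner (g i) x v (w *m J i x).

Definition anti_lee_form (R : realType) (n : nat) (M : manifold R (2 * n + 2))
    (J : complex_structure M) (g : riemannian M) (i : chart M)
    (x v : 'rV[R]_(2 * n + 2)) : R :=
  n%:R^-1 * codiff2 (g i) (fundamental_form J g i) x v.

Definition lee_form (R : realType) (n : nat) (M : manifold R (2 * n + 2))
    (J : complex_structure M) (g : riemannian M) (i : chart M)
    (x v : 'rV[R]_(2 * n + 2)) : R := anti_lee_form J g i x (v *m J i x).

Definition lee_field (R : realType) (n : nat) (M : manifold R (2 * n + 2))
    (J : complex_structure M) (g : riemannian M) (i : chart M) :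
    'rV[R]_(2 * n + 2) -> 'rV[R]_(2 * n + 2) :=
  sharp (g i) (lee_form J g i).

Definition anti_lee_field (R : realType) (n : nat) (M : manifold R (2 * n + 2))
    (J : complex_structure M) (g : riemannian M) (i : chart M) :
    'rV[R]_(2 * n + 2) -> 'rV[R]_(2 * n + 2) :=
  sharp (g i) (anti_lee_form J g i).

Definition lck (R : realType) (n : nat) (M : manifold R (2 * n + 2))
    (J : complex_structure M) (g : riemannian M) : Prop :=
  [/\ hermitian J g,
      forall i x u v w, codomain i x ->
        extd2 (fundamental_form J g i) x u v w =
        wedge12 (lee_form J g i) (fundamental_form J g i) x u v w
    & forall i x v w, codomain i x -> extd1 (lee_form J g i) x v w = 0].

(** * Integrable distributions *)

(* A rank-k distribution D, given in chart i at x as the subspace D i x, is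
   integrable when through every point p passes a k-dimensional integral
   manifold: a smooth injective immersion f from an open neighbourhood W of 0 in
   R^k with f 0 = p and whose tangent space at every point is D. *)
Definition integrable_distribution (R : realType) (m k : nat)
    (M : manifold R m) (D : chart M -> 'rV[R]_m -> set 'rV[R]_m) : Prop :=
  forall p : M, exists (W : set 'rV[R]_k) (f : 'rV[R]_k -> M),
    [/\ open W, W 0, f 0 = p,
        {in W &, injective f}
      & (forall y, W y -> {for y, continuous f}) /\
        forall i : chart M,
          smooth_on (W `&` f @^-1` chart_dom i) (chart_map i \o f) /\
          forall y, W y -> chart_dom i (f y) ->
            injective ('d (chart_map i \o f) y) /\
            range ('d (chart_map i \o f) y) = D i (chart_map i (f y))].

Definition integrable_lck (R : realType) (n : nat) (M : manifold R (2 * n + 2))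
    (J : complex_structure M) (g : riemannian M) : Prop :=
  [/\ lck J g,
      forall i x, codomain i x -> anti_lee_field J g i x != 0
    & integrable_distribution (2 * n + 1)
        (fun i x => [set v | anti_lee_form J g i x v = 0])].

Definition lee_killing (R : realType) (n : nat) (M : manifold R (2 * n + 2))
    (J : complex_structure M) (g : riemannian M) : Prop :=
  forall i x v w, codomain i x -> lie_metric (g i) (lee_field J g i) x v w = 0.

(** * Completeness *)

Definition geodesic (R : realType) (m : nat) (M : manifold R m)
    (g : riemannian M) (c : R -> M) : Prop :=
  continuous c /\
  forall i : chart M,
    let ci := chart_map i \o c in
    smooth_on (c @^-1` chart_dom i) ci /\
    forall t, chart_dom i (c t) ->
      derive1 (derive1 ci) t
      + christoffel (g i) (ci t) (derive1 ci t) (derive1 ci t) = 0.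

(* Geodesic completeness: the exponential map is defined on all of TM (for
   connected M, equivalent to metric completeness by Hopf-Rinow). *)
Definition complete_riemannian (R : realType) (m : nat) (M : manifold R m)
    (g : riemannian M) : Prop :=
  forall (i : chart M) (p : M) (v : 'rV[R]_m), chart_dom i p ->
    exists c : R -> M,
      [/\ geodesic g c, c 0 = p & derive1 (chart_map i \o c) 0 = v].

(* Main.v *)
Require Import Defs.
From HB Require Import structures.
From mathcomp Require Import all_boot all_order all_algebra.
From mathcomp Require Import all_classical all_reals all_analysis.
From mathcomp Require Import ring lra.

(** The theorem holds because, on an LCK manifold, the Killing condition on the
    Lee field [U] and the integrability of [ker eta] contradict each other at
    every point: they give [d eta] different values on a complex line.

    The real dimension is larger than 2, so at any point there is a non-zero
    vector [v] with [eta v = eta (J v) = 0].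

    On the one hand, [eta] vanishes identically on the integral manifolds of
    [ker eta], so [d eta] vanishes on pairs of vectors of [ker eta]
    ([annihilator_closed_on_tangent], which rests on the symmetry of second
    derivatives, [mixed_derivatives_eq]).  Hence [d eta (v, J v) = 0].

    On the other hand, [eta = - i_U Omega], so Cartan's formula
    ([cartan_formula]) gives [d eta = i_U dOmega - L_U Omega].  As [U] is
    Killing, [L_U Omega (v, w) = g (v, A w)] with [A = L_U J].  The endomorphism
    [A] anticommutes with [J] because [J] squares to [-1], and it is skew for
    [g] because [L_U Omega] is antisymmetric.  Then [g (v, A (J v))] equals
    [- g (v, J (A v)) = g (J v, A v)] by the first property and the skewness of
    [J], and [- g (J v, A v)] by the second, so it is zero
    ([lie_fundamental_complex_line]).  Finally [dOmega = theta /\ Omega], and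
    [theta] vanishes on [v] and [J v], so
    [d eta (v, J v) = theta U * Omega (v, J v) = - |U|^2 |v|^2]
    ([extd1_anti_lee]), which is non-zero because [U] vanishes only where the
    anti-Lee field does.

    All computations take place in one chart, with row vectors: endomorphisms
    act on the right, and the fundamental form is the bilinear form with matrix
    [G *m J^T].  That the anti-Lee form and the Lee field have differentiable
    coefficients follows from their expression by the metric, its inverse, the
    complex structure and their derivatives. *)

Set Implicit Arguments.
Unset Strict Implicit.
Unset Printing Implicit Defensive.
Import Order.TTheory GRing.Theory Num.Theory.
Import numFieldNormedType.Exports.
Local Open Scope classical_set_scope.
Local Open Scope ring_scope.

(** * Differentiability and mixed derivatives *)

Lemma near_open (R : realType) (V : normedModType R) (A : set V) (x : V) :
  open A -> A x -> \forall y \near x, A y.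
Proof. by move=> oA Ax; apply: open_nbhs_nbhs; split. Qed.

Lemma smooth_on_differentiable (R : realType) (V W : normedModType R)
    (A : set V) (f : V -> W) (x : V) :
  smooth_on A f -> A x -> differentiable f x.
Proof. by move=> sf Ax; case: (sf 1%N) => df _; exact: df. Qed.

Lemma smooth_on_derive_differentiable (R : realType) (V W : normedModType R)
    (A : set V) (f : V -> W) (u x : V) :
  smooth_on A f -> A x -> differentiable ('D_u f) x.
Proof. by move=> sf Ax; case: (sf 2%N) => _ /(_ u)[df _]; exact: df. Qed.

(** The difference [g - f] vanishes near [x], hence is differentiable there
    with differential zero. *)
Lemma near_eq_differentiable (R : realType) (V W : normedModType R)
    (f g : V -> W) (x : V) :
  {near x, f =1 g} -> differentiable f x -> differentiable g x.
Proof.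
move=> fg df.
have -> : g = f + (g - f) by apply/funext => y /=; rewrite /= addrC subrK.
apply: (differentiableD df).
have k0 : g x - f x = 0 by rewrite (nbhs_singleton fg) subrr.
have E : (g - f) \o shift x = cst ((g - f) x) + (\0 : V -> W) +o_ (0 : V) id.
  apply/eqaddoP => _/posnumP[e]; near=> y.
  rewrite !fctE /= k0 addr0.
  have -> : g (y + x) = f (y + x).
    apply/esym; near: y.
    by have := fg; rewrite [\forall z \near x, _](near_shift 0) subr0.
  by rewrite subrr subr0 normr0 mulr_ge0.
have cz : continuous (\0 : V -> W) by move=> y; exact: cvg_cst.
have D := diff_unique cz E.
by apply/diff_locallyP; rewrite D.
Unshelve. all: by end_near. Qed.

Lemma is_derive_line (R : realType) (V : normedModType R) (f : V -> R)
    (c a : V) (s l : R) :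
  is_derive (c + s *: a) a f l ->
  is_derive s 1 (fun t : R => f (c + t *: a)) l.
Proof.
have E : (fun h : R => h^-1 *: ((f \o shift (c + s *: a)) (h *: a)
             - f (c + s *: a))) =
   (fun h : R => h^-1 *: (((fun t => f (c + t *: a)) \o shift s) (h *: 1)
             - f (c + s *: a))).
  apply/funext => h /=; congr (_ *: (f _ - _)).
  by rewrite [h%:A]mulr1 scalerDl addrCA.
case=> d D; split; first by move: d; rewrite /derivable E.
by rewrite -D /derive E.
Qed.

(** The mean value theorem used twice: first along [a] for the increment of [f]
    in direction [b], then along [b] for the derivative [fa]. *)
Lemma mixed_difference (R : realType) (V : normedModType R)
    (f fa fab : V -> R) (x a b : V) (h : R) : 0 < h ->
  (forall s t, s \in `[0, h] -> t \in `[0, h] ->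
    let y := x + s *: a + t *: b in
    is_derive y a f (fa y) /\ is_derive y b fa (fab y)) ->
  exists2 s, s \in `[0, h] & exists2 t, t \in `[0, h] &
    f (x + h *: a + h *: b) - f (x + h *: a) - (f (x + h *: b) - f x)
    = h ^+ 2 * fab (x + s *: a + t *: b).
Proof.
move=> h0 H.
have h_in : h \in `[0, h] by rewrite in_itv /= lexx ltW.
have z_in : 0 \in `[0, h] by rewrite in_itv /= lexx ltW.
pose g s := f (x + h *: b + s *: a) - f (x + s *: a).
have gd s : s \in `[0, h] ->
    is_derive s 1 g (fa (x + h *: b + s *: a) - fa (x + s *: a)).
  move=> sh; apply: is_deriveB; apply: is_derive_line.
    by rewrite addrAC; exact: (H s h sh h_in).1.
  by have := (H s 0 sh z_in).1; rewrite scale0r addr0.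
have gc : {within `[0, h], continuous g}.
  apply: derivable_within_continuous => s sh.
  exact: (@ex_derive _ _ _ _ _ _ _ (gd s sh)).
have [s sh E] := MVT h0 (fun s sh => gd s (subset_itv_oo_cc sh)) gc.
have {}sh := subset_itv_oo_cc sh.
pose k t := fa (x + s *: a + t *: b).
have kd t : t \in `[0, h] -> is_derive t 1 k (fab (x + s *: a + t *: b)).
  by move=> th; apply: is_derive_line; exact: (H s t sh th).2.
have kc : {within `[0, h], continuous k}.
  apply: derivable_within_continuous => t th.
  exact: (@ex_derive _ _ _ _ _ _ _ (kd t th)).
have [t th E'] := MVT h0 (fun t th => kd t (subset_itv_oo_cc th)) kc.
exists s => //; exists t; first exact: subset_itv_oo_cc.
move: E E'; rewrite /g /k !scale0r !addr0 !subr0 (addrAC _ (h *: b) (s *: a)).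
rewrite (addrAC _ (h *: b)) => E E'.
by rewrite expr2 -mulrA mulrC [h * _]mulrC -E' -E; ring.
Qed.

(** Schwarz's theorem.  The second difference of [f] over the parallelogram
    spanned by [h *: a] and [h *: b] is symmetric in [a] and [b], and
    [mixed_difference] writes it as [h ^+ 2] times either mixed derivative at
    a point that tends to [x] with [h]. *)
Lemma mixed_derivatives_eq (R : realType) (V : normedModType R)
    (f fa fb fab fba : V -> R) (x a b : V) :
  (\forall y \near x, [/\ is_derive y a f (fa y), is_derive y b f (fb y),
     is_derive y b fa (fab y) & is_derive y a fb (fba y)]) ->
  {for x, continuous fab} -> {for x, continuous fba} -> fab x = fba x.
Proof.
move=> H cab cba; apply/eqP; rewrite -subr_eq0 -normr_le0.
apply/ler_addgt0Pr => e e0; rewrite add0r.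
have e20 : 0 < e / 2 by rewrite divr_gt0.
have Cab : \forall y \near x, `|fab x - fab y| < e / 2.
  by move/cvgrPdist_lt : cab => /(_ _ e20).
have Cba : \forall y \near x, `|fba x - fba y| < e / 2.
  by move/cvgrPdist_lt : cba => /(_ _ e20).
have : \forall y \near x,
    [/\ [/\ is_derive y a f (fa y), is_derive y b f (fb y),
     is_derive y b fa (fab y) & is_derive y a fb (fba y)],
    `|fab x - fab y| < e / 2 & `|fba x - fba y| < e / 2].
  by near=> y; split; near: y.
move=> /nbhs_normP[r r0 rH].
(* small enough for the parallelogram to stay in the ball of radius r *)
pose h := r / (2 * (1 + `|a| + `|b|)).
have N0 : 0 < 1 + `|a| + `|b| by rewrite -addrA ltr_pwDl.
have h0 : 0 < h by rewrite divr_gt0 // mulr_gt0.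
have small s t : s \in `[0, h] -> t \in `[0, h] ->
    ball_ Num.norm x r (x + s *: a + t *: b).
  rewrite !in_itv /= => /andP[s0 sh] /andP[t0 th].
  rewrite -addrA opprD addNKr normrN.
  apply: le_lt_trans (ler_normD _ _) _; rewrite !normrZ !ger0_norm //.
  apply: (@le_lt_trans _ _ (h * (1 + `|a| + `|b|))).
    rewrite !mulrDr mulr1 -addrA; apply: ler_wpDl; first exact: ltW.
    by apply: lerD; apply: ler_wpM2r.
  rewrite /h invfM mulrA divfK ?gt_eqF // ltr_pdivrMr //.
  by rewrite ltr_pMr // ltr1n.
have [|s sh [t th E1]] := @mixed_difference _ _ f fa fab x a b h h0.
  by move=> s t sh th y; have [[]] := rH _ (small _ _ sh th).
have [|t' th' [s' sh' E2]] := @mixed_difference _ _ f fb fba x b a h h0.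
  move=> t' s' th' sh' y; rewrite /y addrAC.
  by have [[]] := rH _ (small _ _ sh' th').
have /(mulfI _) : h ^+ 2 * fab (x + s *: a + t *: b) =
      h ^+ 2 * fba (x + t' *: b + s' *: a).
  by rewrite -E1 -E2 (addrAC _ (h *: b)); ring.
rewrite expf_neq0 ?gt_eqF // [in X in _ = fba X]addrAC => /(_ isT) E.
have [_ D1 _] := rH _ (small _ _ sh th).
have [_ _ D2] := rH _ (small _ _ sh' th').
rewrite (splitr e) -(subrKA (fab (x + s *: a + t *: b))) {2}E.
apply: le_trans (ler_normD _ _) _; apply: lerD; first exact: ltW.
by rewrite distrC ltW.
Unshelve. all: by end_near. Qed.

(** * Calculus of matrix-valued maps *)

Lemma is_derive_mxP (R : realType) (V : normedModType R) (m n : nat)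
    (A : V -> 'M[R]_(m, n)) (x v : V) (dA : 'M[R]_(m, n)) :
  is_derive x v A dA <->
  forall i j, is_derive x v (fun y => A y i j) (dA i j).
Proof.
split=> [[d <-] i j|H].
  rewrite derive_mx // mxE; apply: derivableP.
  exact: (derivable_mxP _ _ _).1.
have d : derivable A x v by apply/derivable_mxP => i j; apply: ex_derive.
split=> //; rewrite derive_mx //; apply/matrixP => i j; rewrite mxE.
exact: derive_val.
Qed.

Lemma differentiable_mxP (R : realType) (V : normedModType R) (m n : nat)
    (A : V -> 'M[R]_(m, n)) (x : V) :
  differentiable A x <-> forall i j, differentiable (fun y => A y i j) x.
Proof.
split=> [d i j|H].
  exact: (differentiable_comp d (differentiable_coord _ i j)).
have -> : A = \sum_i \sum_j (fun y => A y i j *: delta_mx i j).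
  apply/funext => y; rewrite [A y]matrix_sum_delta fct_sumE.
  by apply: eq_bigr => i _; rewrite fct_sumE.
apply: differentiable_sum => i; apply: differentiable_sum => j.
exact: differentiableZl.
Qed.

Lemma is_derive_mulmx (R : realType) (V : normedModType R) (m n p : nat)
    (A : V -> 'M[R]_(m, n)) (B : V -> 'M[R]_(n, p)) (x v : V) dA dB :
  is_derive x v A dA -> is_derive x v B dB ->
  is_derive x v (fun y => A y *m B y) (dA *m B x + A x *m dB).
Proof.
move=> /is_derive_mxP hA /is_derive_mxP hB; apply/is_derive_mxP => i j.
have -> : (fun y => (A y *m B y) i j) =
    \sum_k ((fun y => A y i k) * (fun y => B y k j)).
  by apply/funext => y; rewrite mxE fct_sumE.
rewrite !mxE -big_split /=.
apply: is_derive_eq; apply: eq_bigr => k _.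
by rewrite addrC; congr (_ + _); rewrite mulrC.
Qed.

Lemma is_derive_trmx (R : realType) (V : normedModType R) (m n : nat)
    (A : V -> 'M[R]_(m, n)) (x v : V) dA :
  is_derive x v A dA -> is_derive x v (fun y => (A y)^T) dA^T.
Proof.
move=> /is_derive_mxP hA; apply/is_derive_mxP => i j; rewrite mxE.
by under [X in is_derive _ _ X _]funext do rewrite mxE; exact: hA.
Qed.

Lemma differentiable_mulmx (R : realType) (V : normedModType R) (m n p : nat)
    (A : V -> 'M[R]_(m, n)) (B : V -> 'M[R]_(n, p)) (x : V) :
  differentiable A x -> differentiable B x ->
  differentiable (fun y => A y *m B y) x.
Proof.
move=> /differentiable_mxP hA /differentiable_mxP hB.
apply/differentiable_mxP => i j.
have -> : (fun y => (A y *m B y) i j) =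
    \sum_k ((fun y => A y i k) * (fun y => B y k j)).
  by apply/funext => y; rewrite mxE fct_sumE.
by apply: differentiable_sum => k; apply: differentiableM.
Qed.

Lemma differentiable_trmx (R : realType) (V : normedModType R) (m n : nat)
    (A : V -> 'M[R]_(m, n)) (x : V) :
  differentiable A x -> differentiable (fun y => (A y)^T) x.
Proof.
move=> /differentiable_mxP hA; apply/differentiable_mxP => i j.
by under [X in differentiable X _]funext do rewrite mxE; exact: hA.
Qed.

Lemma differentiable_prod (R : realType) (V : normedModType R) (I : Type)
    (r : seq I) (f : I -> V -> R) (x : V) :
  (forall i, differentiable (f i) x) ->
  differentiable (fun y => \prod_(i <- r) f i y) x.
Proof.
move=> df; elim: r => [|i r IH].
  under [X in differentiable X _]funext do rewrite big_nil.
  exact: differentiable_cst.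
under [X in differentiable X _]funext do rewrite big_cons.
exact: differentiableM.
Qed.

Lemma differentiable_bigsum (R : realType) (V W : normedModType R) (I : Type)
    (r : seq I) (f : I -> V -> W) (x : V) :
  (forall i, differentiable (f i) x) ->
  differentiable (fun y => \sum_(i <- r) f i y) x.
Proof.
move=> df; elim: r => [|i r IH].
  under [X in differentiable X _]funext do rewrite big_nil.
  exact: differentiable_cst.
under [X in differentiable X _]funext do rewrite big_cons.
exact: differentiableD.
Qed.

Lemma differentiable_det (R : realType) (V : normedModType R) (n : nat)
    (A : V -> 'M[R]_n) (x : V) :
  differentiable A x -> differentiable (fun y => \det (A y)) x.
Proof.
move=> /differentiable_mxP dA; apply: differentiable_bigsum => s.
apply: differentiableM; first exact: differentiable_cst.
exact: differentiable_prod.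
Qed.

Lemma differentiable_adj (R : realType) (V : normedModType R) (n : nat)
    (A : V -> 'M[R]_n) (x : V) :
  differentiable A x -> differentiable (fun y => \adj (A y)) x.
Proof.
move=> /differentiable_mxP dA; apply/differentiable_mxP => i j.
under [X in differentiable X _]funext do rewrite mxE.
apply: differentiableM; first exact: differentiable_cst.
apply: differentiable_det; apply/differentiable_mxP => k l.
by under [X in differentiable X _]funext do rewrite !mxE.
Qed.

(** By Cramer's formula, [invmx] is the adjugate over the determinant near
    [x]. *)
Lemma differentiable_invmx (R : realType) (V : normedModType R) (n : nat)
    (A : V -> 'M[R]_n) (x : V) :
  {near x, forall y, A y \in unitmx} -> differentiable A x ->
  differentiable (fun y => invmx (A y)) x.
Proof.
move=> Au dA.
apply: (@near_eq_differentiable _ _ _ (fun y => (\det (A y))^-1 *: \adj (A y))).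
  by near=> y; rewrite /invmx (near Au y).
have dd := differentiable_det dA.
apply/differentiable_mxP => i j.
under [X in differentiable X _]funext do rewrite mxE.
apply: differentiableM.
  2: exact: (differentiable_mxP _ _).1 (differentiable_adj dA) i j.
apply: differentiableV => //.
by have := nbhs_singleton Au; rewrite unitmxE unitfE.
Unshelve. all: by end_near. Qed.

Lemma linear_form_rowE (R : realType) (m : nat) (f : 'rV[R]_m -> R)
    (v : 'rV[R]_m) :
  (forall a u w, f (a *: u + w) = a * f u + f w) ->
  f v = ((\row_a f (basis_vec R a)) *m v^T) 0 0.
Proof.
move=> lf.
have f0 : f 0 = 0 by have := lf 1 0 0; rewrite scaler0 addr0; lra.
rewrite mxE {1}[v]row_sum_delta.
suff H (s : seq 'I_m) : f (\sum_(j <- s) v 0 j *: delta_mx 0 j) =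
    \sum_(j <- s) (\row_a f (basis_vec R a)) 0 j * v^T j 0 by exact: H.
elim: s => [|j s IH]; first by rewrite !big_nil.
by rewrite !big_cons lf IH !mxE mulrC.
Qed.

(** * Forms that vanish on the tangent spaces of a submanifold *)

(** The direction of Frobenius' theorem which starts from integral manifolds.
    If the [1]-form given by the row [h] kills the tangent vectors of the
    parametrised submanifold [F], differentiating [h (F y) ('D_a F y) = 0] along
    [b] gives [(dh . 'D_b F) ('D_a F) = - h ('D_b 'D_a F)]; the right-hand side
    is symmetric in [a] and [b] by [mixed_derivatives_eq], so the exterior
    derivative of the form vanishes on tangent vectors. *)
Lemma annihilator_closed_on_tangent (R : realType) (k m : nat)
    (O : set 'rV[R]_k) (F : 'rV[R]_k -> 'rV[R]_m) (h : 'rV[R]_m -> 'rV[R]_m)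
    (x a b : 'rV[R]_k) :
  open O -> O x -> smooth_on O F -> differentiable h (F x) ->
  (forall y c, O y -> (h (F y) *m ('D_c F y)^T) 0 0 = 0) ->
  extd1 (fun z v => (h z *m v^T) 0 0) (F x) ('D_a F x) ('D_b F x) = 0.
Proof.
move=> oO Ox sF dh hF.
have nO := near_open oO Ox.
have dF y : O y -> differentiable F y by exact: smooth_on_differentiable.
have ddF y c : O y -> differentiable ('D_c F) y.
  exact: smooth_on_derive_differentiable.
have cF c d : {for x, continuous (fun y => 'D_d ('D_c F) y)}.
  by case: (sF 2%N) => _ /(_ c) [_ /(_ d) cF]; exact: (cF x Ox).
have sym : 'D_b ('D_a F) x = 'D_a ('D_b F) x.
  apply/matrixP => i j.
  have dij y c : O y -> is_derive y c (fun z => F z i j) ('D_c F y i j).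
    move=> Oy; apply: (is_derive_mxP _ _ _ _).1.
    exact/derivableP/diff_derivable/dF.
  have ddij y c d : O y ->
      is_derive y d (fun z => 'D_c F z i j) ('D_d ('D_c F) y i j).
    move=> Oy; apply: (is_derive_mxP _ _ _ _).1.
    exact/derivableP/diff_derivable/ddF.
  have cij c d : {for x, continuous (fun y => 'D_d ('D_c F) y i j)}.
    exact: (@continuous_comp _ _ _ (fun y => 'D_d ('D_c F) y)
      (fun M : 'rV[R]_m => M i j) x (cF c d) (@coord_continuous _ _ _ _ _ _)).
  apply: (@mixed_derivatives_eq _ _ (fun z => F z i j)
    (fun z => 'D_a F z i j) (fun z => 'D_b F z i j)
    (fun z => 'D_b ('D_a F) z i j) (fun z => 'D_a ('D_b F) z i j) x a b) => //.
  near=> y; have Oy : O y by [near: y].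
  by split; [exact: dij..|exact: ddij|exact: ddij].
have dhF c : is_derive x c (h \o F) ('D_('D_c F x) h (F x)).
  have dFx := dF x Ox.
  apply: DeriveDef; first exact/diff_derivable/differentiable_comp.
  rewrite deriveE; last exact: differentiable_comp.
  by rewrite (diff_comp dFx dh) (deriveE c dFx) (deriveE _ dh).
have key c d : ('D_('D_d F x) h (F x) *m ('D_c F x)^T) 0 0 =
    - (h (F x) *m ('D_d ('D_c F) x)^T) 0 0.
  have D := is_derive_mulmx (dhF d)
    (is_derive_trmx (derivableP (@diff_derivable _ _ _ _ _ d (ddF x c Ox)))).
  have /is_derive_mxP /(_ 0 0) D00 := D.
  apply/eqP; rewrite -addr_eq0; apply/eqP; move: D00; rewrite mxE => D00.
  rewrite -[LHS](@derive_val _ _ _ _ _ _ _ D00).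
  rewrite (@near_eq_derive _ _ _ _ (cst 0)); first exact: derive_cst.
  by near=> y; apply: (hF y c); near: y.
have dhv v : derivable h (F x) v by exact: diff_derivable.
have ext (v w : 'rV[R]_m) :
    'D_v (fun z => (h z *m w^T) 0 0) (F x) = ('D_v h (F x) *m w^T) 0 0.
  have /is_derive_mxP /(_ 0 0) D := is_derive_mulmx (derivableP (dhv v))
    (is_derive_cst w^T (F x) v).
  by rewrite (@derive_val _ _ _ _ _ _ _ D) mulmx0 addr0.
have Eab := etrans (ext ('D_a F x) ('D_b F x)) (key b a).
have Eba := etrans (ext ('D_b F x) ('D_a F x)) (key a b).
by rewrite /extd1 [X in X - _]Eab [X in _ - X]Eba sym subrr.
Unshelve. all: by end_near. Qed.

(** * Bilinear forms with varying matrix *)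

Section Inner.
Variables (R : realType) (m : nat).
Implicit Types (A : 'rV[R]_m -> 'M[R]_m) (x u v w : 'rV[R]_m).

Lemma inner_linearl A x w a u v :
  inner A x (a *: u + v) w = a * inner A x u w + inner A x v w.
Proof. by rewrite /inner !mulmxDl -!scalemxAl !mxE. Qed.

Lemma inner_linearr A x w a u v :
  inner A x w (a *: u + v) = a * inner A x w u + inner A x w v.
Proof. by rewrite /inner linearP mulmxDr -scalemxAr !mxE. Qed.

Lemma is_derive_inner A x u v w : derivable A x u ->
  is_derive x u (fun y => inner A y v w) (inner ('D_u A) x v w).
Proof.
move=> /derivableP dA.
have /is_derive_mxP /(_ 0 0) := is_derive_mulmx
   (is_derive_mulmx (is_derive_cst v x u) dA) (is_derive_cst w^T x u).
by rewrite mul0mx add0r mulmx0 addr0.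
Qed.

Lemma derive_inner A x u v w : derivable A x u ->
  'D_u (fun y => inner A y v w) x = inner ('D_u A) x v w.
Proof. by move=> /is_derive_inner dA; exact: derive_val. Qed.

Lemma differentiable_inner A (v w : 'rV[R]_m -> 'rV[R]_m) x :
  differentiable A x -> differentiable v x -> differentiable w x ->
  differentiable (fun y => inner A y (v y) (w y)) x.
Proof.
move=> dA dv dw; apply: (differentiable_mxP _ _).1.
apply: differentiable_mulmx; first exact: differentiable_mulmx.
exact: differentiable_trmx.
Qed.

End Inner.

Lemma derive_linear (R : realType) (V W : normedModType R) (f : V -> W)
    (x : V) a (u v : V) : differentiable f x ->
  'D_(a *: u + v) f x = a *: 'D_u f x + 'D_v f x.
Proof. by move=> df; rewrite !deriveE // linearP. Qed.

Lemma inner_derive_linear (R : realType) (m : nat) (A : 'rV[R]_m -> 'M[R]_m)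
    (x u v w w' : 'rV[R]_m) a : differentiable A x ->
  inner ('D_(a *: v + w) A) x u w' =
  a * inner ('D_v A) x u w' + inner ('D_w A) x u w'.
Proof.
move=> dA; rewrite /inner (derive_linear a v w dA).
have E (P Q : 'M[R]_m) : (u *m (a *: P + Q) *m w'^T) 0 0 =
    a * (u *m P *m w'^T) 0 0 + (u *m Q *m w'^T) 0 0.
  by rewrite mulmxDr mulmxDl -scalemxAr -scalemxAl !mxE.
exact: E.
Qed.

(** * The codifferential of a 2-form in a chart *)

(** The connection and the codifferential are rational in [G], [B] and their
    first derivatives.  This makes the anti-Lee form linear in its vector
    argument, so that it is given by a row of coefficients, and makes these
    coefficients differentiable, as is needed to speak of its exterior
    derivative. *)
Section Codifferential.
Variables (R : realType) (m : nat) (A : set 'rV[R]_m).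
Variables (G B : 'rV[R]_m -> 'M[R]_m).
Hypotheses (oA : open A) (Gunit : forall y, A y -> G y \in unitmx).
Hypotheses (dG : forall y, A y -> differentiable G y)
  (ddG : forall u y, A y -> differentiable ('D_u G) y).
Hypotheses (dB : forall y, A y -> differentiable B y)
  (ddB : forall u y, A y -> differentiable ('D_u B) y).
Implicit Types (x y u v w : 'rV[R]_m).

Lemma christoffelE y u v : A y ->
  christoffel G y u v =
  (\row_a (2^-1 * (inner ('D_u G) y v (basis_vec R a)
                   + inner ('D_v G) y u (basis_vec R a)
                   - inner ('D_(basis_vec R a) G) y u v))) *m invmx (G y).
Proof.
move=> Ay; rewrite /christoffel /sharp; congr (_ *m _); apply/rowP => a.
have dGy w : derivable G y w by exact/diff_derivable/dG.
by rewrite !mxE !derive_inner.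
Qed.

Lemma christoffel_linear y u a v w : A y ->
  christoffel G y u (a *: v + w) =
  a *: christoffel G y u v + christoffel G y u w.
Proof.
move=> Ay; rewrite !christoffelE // scalemxAl -mulmxDl; congr (_ *m _).
apply/rowP => b; rewrite [LHS]mxE [RHS]mxE.
rewrite [X in _ = X + _]mxE [X in _ = _ * X + _]mxE [X in _ = _ + X]mxE.
have E (c i i' j j' k k' : R) : c * (a * i + i' + (a * j + j') - (a * k + k'))
    = a * (c * (i + j - k)) + c * (i' + j' - k') by ring.
rewrite -E; congr (_ * (_ + _ - _)).
- exact: inner_linearl.
- exact/inner_derive_linear/dG.
- exact: inner_linearr.
Qed.

Lemma differentiable_invG x : A x -> differentiable (fun y => invmx (G y)) x.
Proof.
move=> Ax; apply: differentiable_invmx; last exact: dG.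
by near=> y; apply: Gunit; near: y; exact: (near_open oA Ax).
Unshelve. all: by end_near. Qed.

Lemma differentiable_christoffel x u v : A x ->
  differentiable (fun y => christoffel G y u v) x.
Proof.
move=> Ax; apply: (near_eq_differentiable (f := fun y =>
  (\row_a (2^-1 * (inner ('D_u G) y v (basis_vec R a)
                   + inner ('D_v G) y u (basis_vec R a)
                   - inner ('D_(basis_vec R a) G) y u v))) *m invmx (G y))).
  by near=> y; rewrite christoffelE //; near: y; exact: (near_open oA Ax).
apply: differentiable_mulmx; last exact: differentiable_invG.
apply/differentiable_mxP => i a.
under [X in differentiable X _]funext do rewrite mxE.
apply: differentiableM; first exact: differentiable_cst.
apply: differentiableB; first apply: differentiableD.
- by apply: differentiable_inner; [exact: ddG|exact: differentiable_cst..].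
- by apply: differentiable_inner; [exact: ddG|exact: differentiable_cst..].
- by apply: differentiable_inner; [exact: ddG|exact: differentiable_cst..].
Unshelve. all: by end_near. Qed.

Lemma nabla2_linear y u v a w w' : A y ->
  nabla2 G (inner B) y u v (a *: w + w') =
  a * nabla2 G (inner B) y u v w + nabla2 G (inner B) y u v w'.
Proof.
move=> Ay; have dBy : derivable B y u by exact/diff_derivable/dB.
rewrite /nabla2 (derive_inner _ _ dBy).
rewrite (derive_inner v w dBy) (derive_inner v w' dBy).
rewrite (christoffel_linear u a w w' Ay).
have E (i i' j j' k k' : R) : a * i + i' - (a * j + j') - (a * k + k')
    = a * (i - j - k) + (i' - j' - k') by ring.
by rewrite -E; congr (_ - _ - _); exact: inner_linearr.
Qed.

Lemma differentiable_nabla2 x u v w : A x ->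
  differentiable (fun y => nabla2 G (inner B) y u v w) x.
Proof.
move=> Ax; apply: (near_eq_differentiable (f := fun y =>
  inner ('D_u B) y v w - inner B y (christoffel G y u v) w
   - inner B y v (christoffel G y u w))).
  near=> y; rewrite /nabla2 derive_inner //; apply/diff_derivable/dB.
  by near: y; exact: (near_open oA Ax).
apply: differentiableB; first apply: differentiableB.
- by apply: differentiable_inner; [exact: ddB|exact: differentiable_cst..].
- by apply: differentiable_inner; [exact: dB|
    exact: differentiable_christoffel|exact: differentiable_cst].
- by apply: differentiable_inner; [exact: dB|
    exact: differentiable_cst|exact: differentiable_christoffel].
Unshelve. all: by end_near. Qed.

Lemma codiff2_linear y a w w' : A y ->
  codiff2 G (inner B) y (a *: w + w') =
  a * codiff2 G (inner B) y w + codiff2 G (inner B) y w'.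
Proof.
move=> Ay; rewrite /codiff2 mulrN -opprD; congr (- _).
rewrite mulr_sumr -big_split; apply: eq_bigr => i _ /=.
rewrite mulr_sumr -big_split; apply: eq_bigr => j _ /=.
by rewrite nabla2_linear // mulrDr mulrCA.
Qed.

Lemma differentiable_codiff2 x w : A x ->
  differentiable (fun y => codiff2 G (inner B) y w) x.
Proof.
move=> Ax; apply: differentiableN.
apply: differentiable_bigsum => i; apply: differentiable_bigsum => j.
apply: differentiableM; last exact: differentiable_nabla2.
exact: (differentiable_mxP _ _).1 (differentiable_invG Ax) i j.
Qed.

End Codifferential.

(** * The Lie derivative of the fundamental form *)

(** Turns pointwise identities between bilinear forms, such as the Hermitian
    and the Killing conditions, into identities between matrices. *)
Lemma mx_eq_of_forms (R : realType) (m : nat) (A B : 'M[R]_m) :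
  (forall v w : 'rV[R]_m, (v *m A *m w^T) 0 0 = (v *m B *m w^T) 0 0) -> A = B.
Proof.
move=> H; apply/matrixP => i j.
have := H (delta_mx 0 i) (delta_mx 0 j).
by rewrite trmx_delta -!rowE -!colE !mxE.
Qed.

(** [G], [J] are the metric and the complex structure at a point, [G'], [J']
    their derivatives along a vector field [U], and [P] is the matrix of the
    derivative of [U]; [kill] says that the Lie derivative of the metric
    vanishes.  The matrix in front of [J^T] in [S] is that of [L_U Omega].  For
    [U] Killing, [L_U Omega (v, w) = g (v, (L_U J) w)], where [L_U J]
    anticommutes with [J] because [J] squares to [-1], and is skew for [g]
    because [L_U Omega] is antisymmetric; therefore [(L_U J) J] is skew too,
    which is the conclusion. *)
Lemma lie_fundamental_skew (R : realType) (m : nat) (G J G' J' P : 'M[R]_m) :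
  G^T = G -> J *m J = - 1%:M -> J *m G *m J^T = G ->
  J' *m J + J *m J' = 0 ->
  J' *m G *m J^T + J *m G' *m J^T + J *m G *m J'^T = G' ->
  G' + P *m G + G *m P^T = 0 ->
  let B := G *m J^T in let B' := G' *m J^T + G *m J'^T in
  let S := (B' + P *m B + B *m P^T) *m J^T in S + S^T = 0.
Proof.
move=> sG JJ JGJ dJJ dJGJ kill B B' S.
have JtJt : J^T *m J^T = - 1%:M by rewrite -trmx_mul JJ linearN /= trmx1.
have BE : B = - (J *m G).
  by rewrite /B -{1}JGJ -!mulmxA JtJt !mulmxN mulmx1.
have JtJ't : J'^T *m J^T = - (J^T *m J'^T).
  apply/eqP; rewrite -addr_eq0 -!trmx_mul -linearD /= addrC.
  by rewrite dJJ linear0.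
have G'E : G' = - (P *m G + G *m P^T).
  by apply/eqP; rewrite -addr_eq0 addrA kill.
have SE : S = G *m P^T + J *m G *m J'^T - J *m (G *m P^T) *m J^T.
  rewrite /S !mulmxDl.
  have -> : G' *m J^T *m J^T = P *m G + G *m P^T.
    by rewrite -mulmxA JtJt mulmxN mulmx1 G'E opprK.
  have -> : G *m J'^T *m J^T = J *m G *m J'^T.
    by rewrite -mulmxA JtJ't mulmxN mulmxA -/B BE mulNmx opprK.
  have -> : P *m B *m J^T = - (P *m G).
    by rewrite /B -!mulmxA JtJt !mulmxN mulmx1.
  have -> : B *m P^T *m J^T = - (J *m (G *m P^T) *m J^T).
    by rewrite BE !mulNmx !mulmxA.
  move: (P *m G) (G *m P^T) (J *m G *m J'^T) (J *m _ *m _) => a b c d.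
  by apply/matrixP => i j; rewrite !mxE; ring.
have trE (a b c : 'M[R]_m) : (a + b - c)^T = a^T + b^T - c^T.
  by apply/matrixP => i j; rewrite !mxE.
rewrite {}SE trE !trmx_mul !trmxK sG !mulmxA.
have -> : J' *m G *m J^T = G' - J *m G' *m J^T - J *m G *m J'^T.
  move: dJGJ; move: (J' *m G *m _) (J *m G' *m _) (J *m G *m _) => a b c <-.
  by apply/matrixP => i j; rewrite !mxE; ring.
rewrite G'E mulmxN mulNmx mulmxDr mulmxDl !mulmxA.
move: (P *m G) (G *m P^T) (J *m G *m J'^T) (J *m G *m _ *m _)
  (J *m P *m G *m _) => a b c d e.
apply/matrixP => i j; rewrite !mxE; ring.
Qed.

Lemma form_trmxC (R : realType) (m : nat) (S : 'M[R]_m) (v w : 'rV[R]_m) :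
  (v *m S^T *m w^T) 0 0 = (w *m S *m v^T) 0 0.
Proof.
have -> : v *m S^T *m w^T = (w *m S *m v^T)^T.
  by rewrite !trmx_mul trmxK mulmxA.
by rewrite mxE.
Qed.

Lemma skew_form_diag (R : realType) (m : nat) (S : 'M[R]_m) (v : 'rV[R]_m) :
  S + S^T = 0 -> (v *m S *m v^T) 0 0 = 0.
Proof.
move=> S0; have : (v *m (S + S^T) *m v^T) 0 0 = 0.
  by rewrite S0 mulmx0 mul0mx mxE.
by rewrite mulmxDr mulmxDl mxE form_trmxC; lra.
Qed.

(** [lie_metric A U] only uses that [A] is the matrix of a bilinear form, so it
    also computes the Lie derivative of the fundamental form. *)
Lemma lie_metricE (R : realType) (m : nat) (A : 'rV[R]_m -> 'M[R]_m)
    (U : 'rV[R]_m -> 'rV[R]_m) (x v w : 'rV[R]_m) :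
  derivable A x (U x) ->
  lie_metric A U x v w =
  inner ('D_(U x) A) x v w + inner A x ('D_v U x) w + inner A x v ('D_w U x).
Proof.
move=> dA.
have br c : bracket U (cst c) x = - 'D_c U x.
  by have D0 := derive_cst c x (U x); rewrite /bracket D0 sub0r.
have El c : inner A x (- 'D_c U x) w = - inner A x ('D_c U x) w.
  by rewrite /inner !mulNmx mxE.
have Er c : inner A x v (- 'D_c U x) = - inner A x v ('D_c U x).
  by rewrite /inner linearN mulmxN mxE.
by rewrite /lie_metric (derive_inner v w dA) (br v) (br w) (El v) (Er w) !opprK.
Qed.

(** Cartan's formula [L_U = i_U d + d i_U] for the skew form with matrix
    [B]. *)
Lemma cartan_formula (R : realType) (m : nat) (B : 'rV[R]_m -> 'M[R]_m)
    (U : 'rV[R]_m -> 'rV[R]_m) (x v w : 'rV[R]_m) :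
  (\forall y \near x, (B y)^T = - B y) ->
  differentiable B x -> differentiable U x ->
  lie_metric B U x v w =
  extd2 (inner B) x (U x) v w + extd1 (fun y => inner B y (U y)) x v w.
Proof.
move=> Bskew dB dU.
have dBu u : derivable B x u by exact: diff_derivable.
have dUu u : is_derive x u U ('D_u U x) by exact/derivableP/diff_derivable.
have skew a b : inner B x a b = - inner B x b a.
  by rewrite /inner -form_trmxC (nbhs_singleton Bskew) mulmxN mulNmx mxE.
have skewd u a b : inner ('D_u B) x a b = - inner ('D_u B) x b a.
  rewrite -(derive_inner a b (dBu u)) -(derive_inner b a (dBu u)).
  rewrite -deriveN; last first.
    exact: (@ex_derive _ _ _ _ _ _ _ (is_derive_inner b a (dBu u))).
  apply: near_eq_derive; near=> y.
  rewrite /inner -form_trmxC [LHS](_ : _ = (b *m - B y *m a^T) 0 0).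
    by rewrite mulmxN mulNmx mxE.
  by rewrite (near Bskew y).
have contr u c : 'D_u (fun y => inner B y (U y) c) x =
    inner B x ('D_u U x) c + inner ('D_u B) x (U x) c.
  have /is_derive_mxP /(_ 0 0) D := is_derive_mulmx
    (is_derive_mulmx (dUu u) (derivableP (dBu u))) (is_derive_cst c^T x u).
  rewrite (@derive_val _ _ _ _ _ _ _ D) mulmx0 addr0 mulmxDl mxE.
  by [].
rewrite lie_metricE // /extd2 /extd1 (contr v w) (contr w v).
rewrite (derive_inner v w (dBu _)) (derive_inner w (U x) (dBu _)).
rewrite (derive_inner (U x) v (dBu _)).
have E (p q r s t r' s' : R) : s = - s' -> r = - r' ->
  p + q + r = p + s + t + (q + s' - (r' + t)) by move=> -> ->; ring.
exact: E (skewd v w (U x)) (skew v ('D_w U x)).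
Unshelve. all: by end_near. Qed.

(** * The exterior derivative of the anti-Lee form *)

Section LocalGeometry.
Variables (R : realType) (m : nat).
Variables (G J : 'rV[R]_m -> 'M[R]_m) (x : 'rV[R]_m).
Hypotheses (dG : differentiable G x) (dJ : differentiable J x).
Hypothesis Gsym : \forall y \near x, (G y)^T = G y.
Hypothesis JJ : \forall y \near x, J y *m J y = - 1%:M.
Hypothesis JGJ : \forall y \near x, J y *m G y *m (J y)^T = G y.

Let B y := G y *m (J y)^T.

Lemma is_derive_fundamental u :
  is_derive x u B ('D_u G x *m (J x)^T + G x *m ('D_u J x)^T).
Proof.
have dGu : is_derive x u G ('D_u G x) by exact/derivableP/diff_derivable.
have dJu : is_derive x u J ('D_u J x) by exact/derivableP/diff_derivable.
exact: (is_derive_mulmx dGu (is_derive_trmx dJu)).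
Qed.

Lemma differentiable_fundamental : differentiable B x.
Proof. by apply: differentiable_mulmx => //; exact: differentiable_trmx. Qed.

Lemma fundamental_skew : \forall y \near x, (B y)^T = - B y.
Proof.
near=> y; rewrite /B trmx_mul trmxK (near Gsym y) //.
rewrite -{2}(near JGJ y) // -[in RHS]mulmxA -trmx_mul (near JJ y) //.
by rewrite linearN /= trmx1 mulmxN mulmx1 opprK.
Unshelve. all: by end_near. Qed.

(** A Killing field need not preserve [Omega], but its Lie derivative of
    [Omega] vanishes on every complex line: see [lie_fundamental_skew]. *)
Lemma lie_fundamental_complex_line (U : 'rV[R]_m -> 'rV[R]_m) (v : 'rV[R]_m) :
  differentiable U x -> (forall v w, lie_metric G U x v w = 0) ->
  lie_metric B U x v (v *m J x) = 0.
Proof.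
move=> dU kill.
pose u := U x; pose P := 'J U x.
have dUP c : 'D_c U x = c *m P by exact: deriveEjacobian.
have dGu : is_derive x u G ('D_u G x) by exact/derivableP/diff_derivable.
have dJu : is_derive x u J ('D_u J x) by exact/derivableP/diff_derivable.
have mxform (A : 'rV[R]_m -> 'M[R]_m) a b : derivable A x u ->
    lie_metric A U x a b =
    (a *m ('D_u A x + P *m A x + A x *m P^T) *m b^T) 0 0.
  move=> dA; rewrite lie_metricE // /inner (dUP a) (dUP b) trmx_mul.
  rewrite !mulmxDr !mulmxDl !mulmxA.
  by rewrite [in RHS]mxE [X in _ = X + _]mxE.
have killM : 'D_u G x + P *m G x + G x *m P^T = 0.
  apply: mx_eq_of_forms => a b.
  by rewrite mulmx0 mul0mx [RHS]mxE -(mxform G) ?kill //.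
have dJJ : 'D_u J x *m J x + J x *m 'D_u J x = 0.
  rewrite -[LHS](@derive_val _ _ _ _ _ _ _ (is_derive_mulmx dJu dJu)).
  by rewrite (near_eq_derive _ JJ) derive_cst.
have dJGJ : 'D_u J x *m G x *m (J x)^T + J x *m 'D_u G x *m (J x)^T
    + J x *m G x *m ('D_u J x)^T = 'D_u G x.
  have D := is_derive_mulmx (is_derive_mulmx dJu dGu) (is_derive_trmx dJu).
  rewrite -mulmxDl -[LHS](@derive_val _ _ _ _ _ _ _ D).
  exact: near_eq_derive.
have dBu := is_derive_fundamental u.
rewrite mxform; last exact: ex_derive.
rewrite (@derive_val _ _ _ _ _ _ _ dBu) trmx_mul mulmxA.
rewrite -[X in X *m v^T]mulmxA; apply: skew_form_diag.
exact: (lie_fundamental_skew (nbhs_singleton Gsym) (nbhs_singleton JJ)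
  (nbhs_singleton JGJ) dJJ dJGJ killM).
Qed.

(** As [eta = - i_U Omega], Cartan's formula gives
    [d eta = i_U dOmega - L_U Omega].  At [(v, J v)] the Lie derivative
    vanishes, and all terms of [i_U (theta /\ Omega)] but
    [theta U * Omega (v, J v)] contain [theta v] or [theta (J v)], which are
    zero as [theta] is [eta] composed with [J]. *)
Lemma extd1_anti_lee (h U : 'rV[R]_m -> 'rV[R]_m) (v : 'rV[R]_m) :
  let eta y w := (h y *m w^T) 0 0 in
  differentiable U x ->
  (\forall y \near x, forall w, inner G y (U y) w = eta y (w *m J y)) ->
  (forall v w, lie_metric G U x v w = 0) ->
  (forall a b c, extd2 (inner B) x a b c =
     wedge12 (fun y w => eta y (w *m J y)) (inner B) x a b c) ->
  eta x v = 0 -> eta x (v *m J x) = 0 ->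
  extd1 eta x v (v *m J x) = - (inner G x (U x) (U x) * inner G x v v).
Proof.
move=> eta dU etaU kill dOm ev evJ.
set w := v *m J x.
have wJ : w *m J x = - v.
  by rewrite /w -mulmxA (nbhs_singleton JJ) mulmxN mulmx1.
have etaN y a : eta y (- a) = - eta y a.
  by rewrite /eta linearN mulmxN [LHS]mxE.
have BG y a b : inner B y a b = inner G y a (b *m J y).
  by rewrite /inner /B trmx_mul !mulmxA.
have etaE : \forall y \near x, forall a, eta y a = - inner B y (U y) a.
  near=> y => a; rewrite BG (near etaU y) //.
  by rewrite -mulmxA (near JJ y) // mulmxN mulmx1 etaN opprK.
(* eta and - i_U Omega agree near x, hence so do their derivatives at x *)
have ext : extd1 eta x v w = - extd1 (fun y => inner B y (U y)) x v w.
  have dBU c d : derivable (fun y => inner B y (U y) c) x d.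
    apply: diff_derivable; apply: differentiable_inner => //.
    exact: differentiable_fundamental.
  have D c d :
      'D_d (fun y => eta y c) x = - 'D_d (fun y => inner B y (U y) c) x.
    rewrite -deriveN //; apply: near_eq_derive.
    by near=> y; exact: (near etaE y).
  by rewrite /extd1 (D w v) (D v w) opprB opprK addrC.
have := cartan_formula v w fundamental_skew differentiable_fundamental dU.
rewrite lie_fundamental_complex_line // dOm /wedge12 -/w wJ etaN ev evJ.
rewrite oppr0 !mul0r !addr0 -(nbhs_singleton etaU) (BG x v w) wJ.
have -> : inner G x v (- v) = - inner G x v v.
  by rewrite /inner linearN mulmxN [LHS]mxE.
by rewrite ext mulrN => /eqP; rewrite eq_sym addrC subr_eq0 => /eqP ->.
Unshelve. all: by end_near. Qed.

End LocalGeometry.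

(** * Lee forms and Lee field in a chart *)

(** A null row vector of [G] would have length zero. *)
Lemma posdef_unitmx (R : realType) (m : nat) (G : 'M[R]_m) :
  (forall v : 'rV[R]_m, v != 0 -> 0 < (v *m G *m v^T) 0 0) -> G \in unitmx.
Proof.
move=> pos; rewrite -row_free_unit -kermx_eq0; apply/negP => /negP.
move=> /rowV0Pn[v /sub_kermxP vG v0].
by have := pos v v0; rewrite vG mul0mx mxE ltxx.
Qed.

(** An [m]-by-[2] matrix has rank at most [2], hence a non-trivial row kernel
    when [2 < m]. *)
Lemma common_zero_of_two_forms (R : realType) (m : nat) (h k : 'rV[R]_m) :
  (2 < m)%N ->
  exists v : 'rV[R]_m, [/\ v != 0, (h *m v^T) 0 0 = 0 & (k *m v^T) 0 0 = 0].
Proof.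
move=> m2; have : kermx (row_mx h^T k^T) != 0.
  rewrite kermx_eq0 /row_free neq_ltn (leq_ltn_trans _ m2) //.
  exact: rank_leq_col.
move=> /rowV0Pn[v /sub_kermxP]; rewrite mul_mx_row => E v0; exists v.
have /eq_row_mx[Eh Ek] : row_mx (v *m h^T) (v *m k^T) = row_mx 0 0.
  by rewrite E row_mx0.
have E0 (l : 'rV[R]_m) : v *m l^T = 0 -> (l *m v^T) 0 0 = 0.
  move=> El; have -> : l *m v^T = (v *m l^T)^T by rewrite trmx_mul trmxK.
  by rewrite El trmx0 mxE.
by split=> //; exact: E0.
Qed.

Section Chart.
Variables (R : realType) (n : nat) (M : manifold R (2 * n + 2)).
Variables (J : complex_structure M) (g : riemannian M) (i : chart M).
Hypothesis lckJ : lck J g.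
Let A := codomain i.
Let m := (2 * n + 2)%N.
Implicit Types (x y u v w : 'rV[R]_m).

Let oA : open A. Proof. exact: chart_codom_open. Qed.
Let dG y : A y -> differentiable (g i) y.
Proof. by apply: smooth_on_differentiable; exact: gram_smooth. Qed.
Let dJ y : A y -> differentiable (J i) y.
Proof. by apply: smooth_on_differentiable; exact: cplx_smooth. Qed.
Let ddG u y : A y -> differentiable ('D_u (g i)) y.
Proof. by apply: smooth_on_derive_differentiable; exact: gram_smooth. Qed.
Let ddJ u y : A y -> differentiable ('D_u (J i)) y.
Proof. by apply: smooth_on_derive_differentiable; exact: cplx_smooth. Qed.

Let JGJ y : A y -> J i y *m g i y *m (J i y)^T = g i y.
Proof.
move=> Ay; apply: mx_eq_of_forms => v w; case: lckJ => herm _ _.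
by rewrite -[RHS](herm i y v w Ay) /inner trmx_mul !mulmxA.
Qed.

Let Gunit y : A y -> g i y \in unitmx.
Proof. by move=> Ay; apply: posdef_unitmx => v; exact: gram_pos. Qed.

Definition fundamental_mx y := g i y *m (J i y)^T.

Lemma fundamental_formE : fundamental_form J g i = inner fundamental_mx.
Proof.
apply/funext => y; apply/funext => v; apply/funext => w.
by rewrite /fundamental_form /inner trmx_mul !mulmxA.
Qed.

Let dB y : A y -> differentiable fundamental_mx y.
Proof.
by move=> Ay; apply: differentiable_fundamental; [exact: dG|exact: dJ].
Qed.

Let ddB u y : A y -> differentiable ('D_u fundamental_mx) y.
Proof.
move=> Ay; apply: (near_eq_differentiable (f := fun z =>
   'D_u (g i) z *m (J i z)^T + g i z *m ('D_u (J i) z)^T)).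
  near=> z; have Az : A z by near: z; exact: (near_open oA Ay).
  have D := is_derive_fundamental (dG Az) (dJ Az) u.
  by rewrite (@derive_val _ _ _ _ _ _ _ D).
apply: differentiableD; apply: differentiable_mulmx.
- exact: ddG.
- exact/differentiable_trmx/dJ.
- exact: dG.
- exact/differentiable_trmx/ddJ.
Unshelve. all: by end_near. Qed.

Definition anti_lee_row y : 'rV[R]_m :=
  \row_a anti_lee_form J g i y (basis_vec R a).

Lemma anti_lee_formE y w :
  A y -> anti_lee_form J g i y w = (anti_lee_row y *m w^T) 0 0.
Proof.
move=> Ay; apply: linear_form_rowE => a u v.
rewrite /anti_lee_form fundamental_formE (codiff2_linear dG dB a u v Ay).
by rewrite mulrDr mulrCA.
Qed.

Lemma differentiable_anti_lee_row y : A y -> differentiable anti_lee_row y.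
Proof.
move=> Ay; apply/differentiable_mxP => k a.
under [X in differentiable X _]funext do rewrite mxE.
apply: differentiableM; first exact: differentiable_cst.
rewrite fundamental_formE; exact: (differentiable_codiff2 oA).
Qed.

Lemma lee_formE y w :
  A y -> lee_form J g i y w = (anti_lee_row y *m (J i y)^T *m w^T) 0 0.
Proof. by move=> Ay; rewrite /lee_form anti_lee_formE // trmx_mul mulmxA. Qed.

Lemma inner_lee_field y w :
  A y -> inner (g i) y (lee_field J g i y) w = lee_form J g i y w.
Proof.
move=> Ay; apply: (@sharpP _ _ _ _ _ (anti_lee_row y *m (J i y)^T)).
  exact: Gunit.
by move=> v; exact: lee_formE.
Qed.

Lemma differentiable_lee_field y : A y -> differentiable (lee_field J g i) y.
Proof.
move=> Ay; apply: (near_eq_differentiable (f := fun z =>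
   anti_lee_row z *m (J i z)^T *m invmx (g i z))).
  near=> z; have Az : A z by near: z; exact: (near_open oA Ay).
  rewrite /lee_field /sharp; congr (_ *m _); apply/rowP => a.
  by rewrite [RHS]mxE lee_formE // trmx_delta -colE [RHS]mxE.
apply: differentiable_mulmx; last exact: (differentiable_invG oA).
apply: differentiable_mulmx; first exact: differentiable_anti_lee_row.
exact/differentiable_trmx/dJ.
Unshelve. all: by end_near. Qed.

(** [eta w = - theta (J w)], so [eta] vanishes where [theta] does. *)
Lemma lee_field_neq0 y : A y -> anti_lee_field J g i y != 0 ->
  lee_field J g i y != 0.
Proof.
move=> Ay; apply: contra => /eqP U0; apply/eqP.
rewrite /anti_lee_field /sharp; apply/eqP.
suff -> : \row_a anti_lee_form J g i y (basis_vec R a) = 0 by rewrite mul0mx.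
apply/rowP => a; rewrite !mxE; set e := basis_vec R a.
have -> : anti_lee_form J g i y e = lee_form J g i y (- (e *m J i y)).
  by rewrite /lee_form mulNmx -mulmxA (cplx_sqr J Ay) mulmxN mulmx1 opprK.
by rewrite -inner_lee_field // U0 /inner !mul0mx mxE.
Qed.

(** By [extd1_anti_lee] the value is [- |U|^2 |v|^2]. *)
Lemma anti_lee_not_closed x v : A x -> lee_killing J g ->
  lee_field J g i x != 0 -> v != 0 ->
  anti_lee_form J g i x v = 0 -> anti_lee_form J g i x (v *m J i x) = 0 ->
  extd1 (fun y w => (anti_lee_row y *m w^T) 0 0) x v (v *m J i x) != 0.
Proof.
move=> Ax kill U0 v0.
rewrite (anti_lee_formE v Ax) (anti_lee_formE (v *m J i x) Ax) => ev evJ.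
rewrite (@extd1_anti_lee _ _ _ _ _ (dG Ax) (dJ Ax) _ _ _ _ (lee_field J g i)).
- by rewrite oppr_eq0 mulf_neq0 // gt_eqF // gram_pos.
- by near=> y; apply: gram_sym; near: y; exact: (near_open oA Ax).
- by near=> y; apply: cplx_sqr; near: y; exact: (near_open oA Ax).
- by near=> y; apply: JGJ; near: y; exact: (near_open oA Ax).
- exact: differentiable_lee_field.
- near=> y => w; have Ay : A y by near: y; exact: (near_open oA Ax).
  by rewrite inner_lee_field // /lee_form anti_lee_formE.
- by move=> a b; exact: kill.
- move=> a b c; case: lckJ => _ /(_ i x a b c Ax) + _.
  by rewrite fundamental_formE /wedge12 /lee_form !anti_lee_formE.
- exact: ev.
- exact: evJ.
Unshelve. all: by end_near. Qed.

End Chart.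

(** * The contradiction at a point *)

Theorem theorem3p6 (R : realType) (n : nat) (hn : (1 <= n)%N)
    (M : manifold R (2 * n + 2)) (J : complex_structure M) (g : riemannian M) :
  integrable_lck J g -> lee_killing J g -> ~ complete_riemannian g.
Proof.
move=> [lckJ V0 integ] kill _.
have [p _] := space_nonempty M; have [i ip] := chart_cover p.
have [W [f [oW W0 f0 _ [cf /(_ i)[sF tF]]]]] := integ p.
set O := W `&` _ in sF; set F := chart_map i \o f in sF tF.
pose x := chart_map i p.
have Ax : codomain i x by exists p.
have F0 : F 0 = x by rewrite /F /= f0.
have O0 : O 0 by split => //=; rewrite f0.
have oO : open O.
  rewrite openE => y [Wy /= fy]; rewrite /interior.
  apply: filterI; first exact: open_nbhs_nbhs.
  apply: (cf y Wy); apply: open_nbhs_nbhs; split => //.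
  exact: chart_dom_open.
have m2 : (2 < 2 * n + 2)%N by rewrite addn2 !ltnS muln_gt0.
(* a complex line inside the kernel of eta *)
have [v [v0 ev evJ]] := common_zero_of_two_forms (anti_lee_row J g i x)
  (anti_lee_row J g i x *m (J i x)^T) m2.
have ev' : anti_lee_form J g i x v = 0 by rewrite (anti_lee_formE J g v Ax).
have evJ' : anti_lee_form J g i x (v *m J i x) = 0.
  by rewrite (anti_lee_formE J g _ Ax) trmx_mul mulmxA.
have U0 := lee_field_neq0 Ax (V0 i x Ax).
have /negP[] := anti_lee_not_closed lckJ Ax kill U0 v0 ev' evJ'.
have dF y : O y -> differentiable F y by exact: smooth_on_differentiable.
have tangent w : anti_lee_form J g i x w = 0 -> exists a, 'D_a F 0 = w.
  move=> ew; have [_ rF] := tF 0 W0 O0.2.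
  have : range ('d F 0) w by rewrite rF f0.
  by case=> a _ <-; exists a; rewrite deriveE //; exact: dF.
have [a Ea] := tangent v ev'; have [b Eb] := tangent _ evJ'.
apply/eqP; rewrite -Eb -Ea -F0.
apply: (annihilator_closed_on_tangent a b oO O0 sF).
  by rewrite F0; exact: differentiable_anti_lee_row.
move=> y c Oy; have [Wy fy] := Oy; have [_ rF] := tF y Wy fy.
have : range ('d F y) ('d F y c) by exists c.
have AFy : codomain i (F y) by exists (f y).
by rewrite rF /= (anti_lee_formE J g _ AFy) (deriveE c (dF y Oy)).
Qed.
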